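(* For $\epsilon>0$ consider the scaled Brio system $$u_t+\Big(\frac{u^2}{2}+\frac{\epsilon}{2}\rho^2\Big)_x=0,\qquad \rho_t+(u\rho-\epsilon\rho)_x=0,\qquad x\in\mathbb{R},\ t>0.$$ The functions $$\eta(u,\rho)=\frac12u^2+\frac{\epsilon}{2}\rho^2,\qquad q(u,\rho)=\frac13u^3+\Big(u-\frac{\epsilon}{2}\Big)\epsilon\rho^2$$ form an entropy-entropy flux pair for this system, with $\eta$ strictly convex. Moreover, if $u_l>u_r$ and $\rho_l,\rho_r>0$, then for all sufficiently small $\epsilon>0$ the Lax-admissible two-shock solution $(u^\epsilon,\rho^\epsilon)$ of this system with initial data $(u_l,\rho_l)$ for $x<0$ and $(u_r,\rho_r)$ for $x>0$ is entropy admissible with respect to $(\eta,q)$, that is, $$\iint_{\mathbb{R}\times(0,\infty)}\big(\eta(u^\epsilon,\rho^\epsilon)\varphi_t+q(u^\epsilon,\rho^\epsilon)\varphi_x\big)\,dx\,dt\ge0$$ for every non-negative test function $\varphi$ with compact support in $\mathbb{R}\times(0,\infty)$.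
   Context: For a $2\times2$ system $u_t+(f_1(u,\rho))_x=0$, $\rho_t+(f_2(u,\rho))_x=0$ with flux $F=(f_1,f_2)$, a continuously differentiable function $\eta:\mathbb{R}^2\to\mathbb{R}$ is an entropy with entropy flux $q:\mathbb{R}^2\to\mathbb{R}$ if $D\eta(u,\rho)\cdot DF(u,\rho)=Dq(u,\rho)$; $(\eta,q)$ is then called an entropy-entropy flux pair. The Lax-admissible two-shock solution: for $u_l>u_r$ and $\epsilon>0$ small there is a unique intermediate state $(u^*_\epsilon,\rho^*_\epsilon)$ such that $(u_l,\rho_l)$ is connected to $(u^*_\epsilon,\rho^*_\epsilon)$ by a Lax-admissible 1-shock of speed $s_{1,\epsilon}$, and $(u^*_\epsilon,\rho^*_\epsilon)$ is connected to $(u_r,\rho_r)$ by a Lax-admissible 2-shock of speed $s_{2,\epsilon}$. Then $(u^\epsilon,\rho^\epsilon)$ equals $(u_l,\rho_l)$ for $x<s_{1,\epsilon}t$, $(u^*_\epsilon,\rho^*_\epsilon)$ for $s_{1,\epsilon}t<x<s_{2,\epsilon}t$, and $(u_r,\rho_r)$ for $x>s_{2,\epsilon}t$. Here a shock of speed $s$ from left state $(\bar u,\bar\rho)$ to right state $(u,\rho)$ satisfies the Rankine-Hugoniot conditions $$(u-\bar u)s=\tfrac12(u^2-\bar u^2)+\tfrac{\epsilon}{2}(\rho^2-\bar\rho^2),\qquad (\rho-\bar\rho)s=(\rho u-\bar\rho\bar u)-\epsilon(\rho-\bar\rho).$$ With $\lambda_{1}(u,\rho)=u-\frac{\epsilon}{2}-\frac12\sqrt{4\epsilon\rho^2+\epsilon^2}$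 and $\lambda_{2}(u,\rho)=u-\frac{\epsilon}{2}+\frac12\sqrt{4\epsilon\rho^2+\epsilon^2}$, it is a Lax-admissible 1-shock if $s<\lambda_1(\bar u,\bar\rho)$ and $\lambda_1(u,\rho)<s<\lambda_2(u,\rho)$, and a Lax-admissible 2-shock if $s>\lambda_2(u,\rho)$ and $\lambda_1(\bar u,\bar\rho)<s<\lambda_2(\bar u,\bar\rho)$. *)

(* Defs.v *)
From HB Require Import structures.
From mathcomp Require Import all_boot all_order all_algebra.
From mathcomp Require Import all_classical all_reals all_analysis.
Set Implicit Arguments.
Unset Strict Implicit.
Unset Printing Implicit Defensive.
Import Order.TTheory GRing.Theory Num.Theory.
Import numFieldNormedType.Exports.
Local Open Scope classical_set_scope.
Local Open Scope ring_scope.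

(* A state is a pair (u, rho); a point of space-time is a pair (x, t). *)

(* Functions of class C^k on the plane, by iterated partial derivatives. *)
Fixpoint Ck (R : realType) (k : nat) (f : R * R -> R) : Prop :=
  if k is k'.+1 then
    [/\ forall p, differentiable f p,
        Ck k' ('D_((1, 0) : R * R) f) &
        Ck k' ('D_((0, 1) : R * R) f)]
  else continuous f.

Definition smooth (R : realType) (f : R * R -> R) : Prop := forall k, Ck k f.

Definition strictly_convex (R : realType) (f : R * R -> R) : Prop :=
  forall (a b : R * R) (t : R), a != b -> 0 < t < 1 ->
    f (t *: a + (1 - t) *: b) < t * f a + (1 - t) * f b.

Definition entropy_pair (R : realType) (F : R * R -> R * R)
    (eta q : R * R -> R) : Prop :=
  [/\ Ck 1 eta,
      forall p, differentiable F p,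
      forall p, differentiable q p &
      forall p v : R * R, 'd eta p ('d F p v) = 'd q p v].

Definition brio_flux (R : realType) (e : R) (U : R * R) : R * R :=
  (U.1 ^+ 2 / 2 + e / 2 * U.2 ^+ 2, U.2 * U.1 - e * U.2).

Definition brio_lambda1 (R : realType) (e : R) (U : R * R) : R :=
  U.1 - e / 2 - Num.sqrt (4 * e * U.2 ^+ 2 + e ^+ 2) / 2.

Definition brio_lambda2 (R : realType) (e : R) (U : R * R) : R :=
  U.1 - e / 2 + Num.sqrt (4 * e * U.2 ^+ 2 + e ^+ 2) / 2.

Definition brio_eta (R : realType) (e : R) (U : R * R) : R :=
  U.1 ^+ 2 / 2 + e / 2 * U.2 ^+ 2.

Definition brio_q (R : realType) (e : R) (U : R * R) : R :=
  U.1 ^+ 3 / 3 + (U.1 - e / 2) * e * U.2 ^+ 2.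

(* In what follows V is the state on the left of the shock, U the state on
   its right and s its speed. *)
Definition rankine_hugoniot (R : realType) (F : R * R -> R * R)
    (V U : R * R) (s : R) : Prop :=
  s *: (U - V) = F U - F V.

Definition lax_1shock (R : realType) (e : R) (V U : R * R) (s : R) : Prop :=
  [/\ rankine_hugoniot (brio_flux e) V U s,
      s < brio_lambda1 e V &
      brio_lambda1 e U < s < brio_lambda2 e U].

Definition lax_2shock (R : realType) (e : R) (V U : R * R) (s : R) : Prop :=
  [/\ rankine_hugoniot (brio_flux e) V U s,
      brio_lambda2 e U < s &
      brio_lambda1 e V < s < brio_lambda2 e V].

(* The condition s1 < s2 says that the intermediate sector
   s1 * t < x < s2 * t is nonempty.  It does not follow from the two Lax
   conditions: for small e > 0 there are also pairs of Lax shocks through a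
   state Um with negative second component, but these have s1 > s2. *)
Definition lax_two_shock (R : realType) (e : R) (Ul Ur Um : R * R)
    (s1 s2 : R) : Prop :=
  [/\ lax_1shock e Ul Um s1, lax_2shock e Um Ur s2 & s1 < s2].

(* The values on the two shock lines, a set of measure zero, are an arbitrary
   convention.  At t = 0 this gives Ul for x < 0 and Ur for x > 0. *)
Definition two_shock_solution (R : realType) (Ul Um Ur : R * R) (s1 s2 : R)
    (p : R * R) : R * R :=
  if p.1 < s1 * p.2 then Ul else if p.1 < s2 * p.2 then Um else Ur.

(* Nonnegative, smooth, with compact support in the open half plane t > 0. *)
Definition nonneg_test_function (R : realType) (phi : R * R -> R) : Prop :=
  [/\ smooth phi,
      forall p, 0 <= phi p,
      compact (closure [set p | phi p != 0]) &
      closure [set p | phi p != 0] `<=` [set p | 0 < p.2]].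

Definition entropy_admissible (R : realType) (eta q : R * R -> R)
    (U : R * R -> R * R) : Prop :=
  forall phi : R * R -> R, nonneg_test_function phi ->
    (0 <= \int[lebesgue_measure \x lebesgue_measure]_(p in
             [set p : measurableTypeR R * measurableTypeR R | (0 < p.2)%R])
          (eta (U p) * 'D_((0, 1) : R * R) phi p
           + q (U p) * 'D_((1, 0) : R * R) phi p)%:E)%E.

(* Main.v *)
Require Import Defs.
From HB Require Import structures.
From mathcomp Require Import all_boot all_order all_algebra.
From mathcomp Require Import all_classical all_reals all_analysis.
From mathcomp Require Import measurable_realfun ring lra.
Import Order.TTheory GRing.Theory Num.Theory.
Import numFieldNormedType.Exports.
Local Open Scope classical_set_scope.
Local Open Scope ring_scope.

(** Along the Hugoniot locus through a state of density r, the slope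
    k = (u - a) / (p - r) satisfies (p + r) (k^2 - e) = 2 e k, and the speed is
    s = a + k p - e.  For small e the Lax conditions together with s1 < s2 force
    the intermediate density p to exceed both outer densities, with k1 < 0 < k2.
    The velocity jump - k1 (p - rl) + k2 (p - rr) is then strictly increasing and
    continuous in p, which determines the intermediate state.  Across each shock
    s [eta] - [q] = - k (p - r)^3 (k^2 + 3 e) / 12 up to orientation, which is
    nonnegative.

    With H_i the indicator of x < s_i t and c_i, d_i the left-minus-right jumps of
    eta and q across the i-th shock, the entropy integrand is
    eta_r phi_t + q_r phi_x
      + sum_i (c_i (phi_t + s_i phi_x) + (d_i - s_i c_i) phi_x) H_i.
    The terms phi_t + s phi_x integrate to 0 (Fubini in the coordinates
    (x - s t, t)), and the integral of phi_x over x < s t is the integral of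
    phi (s t, t) over t. *)

(** * The entropy pair *)

Section Pair.
Context {R : realType}.
Implicit Types (e : R) (p : R * R).

Lemma is_diff_fst p : is_diff p (fst : R * R -> R) fst.
Proof.
have c : continuous (fst : R * R -> R) by move=> x; exact: cvg_fst.
apply: DiffDef; first exact: (linear_differentiable (f:=fst)).
exact: (diff_lin (f := fst)).
Qed.

Lemma is_diff_snd p : is_diff p (snd : R * R -> R) snd.
Proof.
have c : continuous (snd : R * R -> R) by move=> x; exact: cvg_snd.
apply: DiffDef; first exact: (linear_differentiable (f:=snd)).
exact: (diff_lin (f := snd)).
Qed.

Local Notation "'u" := (fst : R * R -> R).
Local Notation "'rho" := (snd : R * R -> R).

Lemma is_diff_brio_eta e p :
  is_diff p (brio_eta e) (fun v => p.1 * v.1 + e * p.2 * v.2).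
Proof.
have -> : brio_eta e = 2^-1 *: 'u ^+ 2 + (e / 2) *: 'rho ^+ 2.
  by apply/funext => v; rewrite /brio_eta !fctE /= mulrC.
have d := is_diffD (is_diffZ 2^-1 (is_diffX 1 (is_diff_fst p)))
  (is_diffZ (e / 2) (is_diffX 1 (is_diff_snd p))).
apply: (is_diff_eq d); apply/funext => v; rewrite !fctE /= /GRing.scale /=.
by field.
Qed.

Lemma is_diff_brio_q e p :
  is_diff p (brio_q e) (fun v => (p.1 ^+ 2 + e * p.2 ^+ 2) * v.1 +
     (2 * e * p.1 - e ^+ 2) * p.2 * v.2).
Proof.
have -> : brio_q e = 3^-1 *: 'u ^+ 3 + e *: ('u * 'rho ^+ 2) - (e ^+ 2 / 2) *: 'rho ^+ 2.
  by apply/funext => v; rewrite /brio_q !fctE /= /GRing.scale /=; ring.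
have d := is_diffB (is_diffD (is_diffZ 3^-1 (is_diffX 2 (is_diff_fst p)))
    (is_diffZ e (is_diffM (is_diff_fst p) (is_diffX 1 (is_diff_snd p)))))
  (is_diffZ (e ^+ 2 / 2) (is_diffX 1 (is_diff_snd p))).
apply: (is_diff_eq d); apply/funext => v; rewrite !fctE /= /GRing.scale /=.
by field.
Qed.

Lemma is_diff_brio_flux e p :
  is_diff p (brio_flux e)
    (fun v => (p.1 * v.1 + e * p.2 * v.2, p.2 * v.1 + (p.1 - e) * v.2)).
Proof.
have h1 := is_diff_brio_eta e p.
have h2 : is_diff p ('rho * 'u - e *: 'rho)
    (fun v => p.2 * v.1 + (p.1 - e) * v.2).
  have d := is_diffB (is_diffM (is_diff_snd p) (is_diff_fst p))
    (is_diffZ e (is_diff_snd p)).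
  apply: (is_diff_eq d).
  by apply/funext => v; rewrite !fctE /= /GRing.scale /=; ring.
(* The first flux component is [brio_eta e] itself, so its differential is reused. *)
rewrite (_ : brio_flux e = fun q => (brio_eta e q, ('rho * 'u - e *: 'rho) q))//.
exact: is_diff_pair.
Qed.

Lemma brio_entropy_pair e : entropy_pair (brio_flux e) (brio_eta e) (brio_q e).
Proof.
have Dv v p : 'D_v (brio_eta e) p = p.1 * v.1 + e * p.2 * v.2.
  have de := is_diff_brio_eta e p; have [dd _] := de.
  by rewrite (deriveE v dd) diff_val.
split.
- split.
  + by move=> p; have [] := is_diff_brio_eta e p.
  + rewrite (_ : 'D_((1, 0) : R * R) _ = 'u); last first.
      by apply/funext => p; rewrite Dv /= mulr1 mulr0 addr0.
    by move=> p; exact: cvg_fst.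
  + rewrite (_ : 'D_((0, 1) : R * R) _ = e *: 'rho); last first.
      by apply/funext => p; rewrite Dv /= mulr1 mulr0 add0r.
    by move=> p; apply: cvgZr; exact: cvg_snd.
- by move=> p; have [] := is_diff_brio_flux e p.
- by move=> p; have [] := is_diff_brio_q e p.
- move=> p v.
  have heta := is_diff_brio_eta e p.
  have hflux := is_diff_brio_flux e p.
  have hq := is_diff_brio_q e p.
  by rewrite !diff_val /=; ring.
Qed.

(** For a quadratic form the convexity gap is [t * (1 - t)] times the form at [a - b], and this form
    is positive definite when [0 < e]. *)
Lemma brio_eta_strictly_convex e : 0 < e -> strictly_convex (brio_eta e).
Proof.
move=> e0 [a1 a2] [b1 b2] t ab /andP[t0 t1]; rewrite /brio_eta /= /GRing.scale /=.
rewrite -subr_gt0.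
set X := (X in 0 < X).
have -> : X = t * (1 - t) / 2 * ((a1 - b1) ^+ 2 + e * (a2 - b2) ^+ 2).
  by rewrite /X; field.
apply: mulr_gt0; first by rewrite divr_gt0 ?mulr_gt0 ?subr_gt0.
have [/eqP a1b1|a1b1] := boolP (a1 == b1).
  have a2b2 : a2 != b2 by apply: contra ab => /eqP ->; rewrite a1b1.
  by rewrite ltr_wpDl ?sqr_ge0// mulr_gt0// exprn_even_gt0// subr_eq0.
apply: ltr_pwDl; first by rewrite exprn_even_gt0// subr_eq0.
by rewrite mulr_ge0 ?sqr_ge0 ?(ltW e0).
Qed.
End Pair.

(** * Lax shocks and the Hugoniot slope *)

Section Slope.
Context {R : realFieldType}.
Implicit Types (e r p k a u s x : R).

(* The slope [k = (u - a) / (p - r)] of the Hugoniot locus joining densities r and p. *)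
Definition hugoniot_slope e r p k : Prop := (p + r) * (k ^+ 2 - e) = 2 * e * k.

Lemma rankine_hugoniot_slope e r p a u s : 0 < e -> 0 < r -> p != r ->
  s * (u - a) = u ^+ 2 / 2 + e / 2 * p ^+ 2 - (a ^+ 2 / 2 + e / 2 * r ^+ 2) ->
  s * (p - r) = p * u - e * p - (r * a - e * r) ->
  exists k, [/\ hugoniot_slope e r p k, u = a + k * (p - r) & s = a + k * p - e].
Proof.
move=> e0 r0 pr; have d0 : p - r != 0 by rewrite subr_eq0.
set k := (u - a) / (p - r).
have uE : u = a + k * (p - r) by rewrite /k; field.
move=> H1 H2.
have sE : s = a + k * p - e.
  by apply: (mulIf d0); rewrite H2 uE; ring.
exists k; split => //; rewrite /hugoniot_slope.
apply: (mulIf d0); move: H1; rewrite sE uE => H1; lra.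
Qed.

(** Handles equal densities: both states then coincide, and the Lax inequalities contradict each
    other. *)
Lemma rankine_hugoniot_const e r a u s : 0 < r ->
  s * (r - r) = r * u - e * r - (r * a - e * r) -> u = a.
Proof.
move=> r0; rewrite subrr mulr0 => H.
have /eqP : r * (u - a) = 0 by lra.
by rewrite mulf_eq0 gt_eqF//= subr_eq0 => /eqP.
Qed.

Lemma hugoniot_slope_sym e r p k : hugoniot_slope e r p k -> hugoniot_slope e p r k.
Proof. by rewrite /hugoniot_slope addrC. Qed.

(** Twice the distance from [s] to the midpoint of the two characteristic speeds is [2 * k * r - e]
    at [(u, p)] and [2 * k * p - e] at [(a, r)]. Comparing [s] with [brio_lambda1] and
    [brio_lambda2] therefore amounts, after squaring, to the sign of the right-hand side, or of its
    mirror image under swapping [r] and [p]. *)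
Lemma hugoniot_slope_sqr e r p k : hugoniot_slope e r p k ->
  (2 * k * r - e) ^+ 2 - (4 * e * p ^+ 2 + e ^+ 2) =
  2 * ((r - p) * (k ^+ 2 * r + e * (r + 2 * p))).
Proof.
rewrite /hugoniot_slope => C.
transitivity (4 * k ^+ 2 * r ^+ 2 - 2 * r * (2 * e * k) - 4 * e * p ^+ 2); first ring.
by rewrite -C; ring.
Qed.

(** If [k] were nonnegative, then [k * (p + r) <= 2 * k * p < 2 * e], whereas the slope equation
    gives [k * (k * (p + r) - 2 * e)] the positive value [e * (p + r)]. *)
Lemma hugoniot_slope_lt0 e r p k : 0 < e -> 0 < r -> r < p ->
  hugoniot_slope e r p k -> 2 * k * p < e -> k < 0.
Proof.
rewrite /hugoniot_slope => e0 r0 rp C kp; rewrite ltNge; apply/negP => k0.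
have pr : 0 < p + r by lra.
have : 0 <= k * (2 * p - (p + r)) by apply: mulr_ge0 => //; lra.
move=> h1.
have : k * (k * (p + r) - 2 * e) = e * (p + r) by lra.
have : 0 < e * (p + r) by apply: mulr_gt0.
have : k * (k * (p + r) - 2 * e) <= 0 by apply: mulr_ge0_le0 => //; lra.
lra.
Qed.

Lemma hugoniot_slope_lt_mid e r p k : 0 < e -> 0 < r -> 0 < p ->
  (r - p) * (k ^+ 2 * r + e * (r + 2 * p)) < 0 -> r < p.
Proof.
move=> e0 r0 p0 A; rewrite ltNge; apply/negP => pr.
suff : 0 <= (r - p) * (k ^+ 2 * r + e * (r + 2 * p)) by rewrite leNgt A.
apply: mulr_ge0; first lra.
apply: addr_ge0; first by rewrite mulr_ge0 ?sqr_ge0 ?(ltW r0).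
by rewrite mulr_ge0 ?(ltW e0)//; lra.
Qed.

(** This is where the threshold [4 * r ^+ 2] arises. If [k ^+ 2 <= e], the slope equation forces
    [0 < p + r], against [B]. Otherwise [p + r < 0], so [e * r ^+ 2 < k ^+ 2 * p ^+ 2], while
    [2 * k * p < e] bounds the right side by [e ^+ 2 / 4]. *)
Lemma hugoniot_slope_excluded e r p k : 0 < e < 4 * r ^+ 2 -> 0 < r -> p < 0 -> k < 0 ->
  hugoniot_slope e r p k ->
  (r - p) * (k ^+ 2 * r + e * (r + 2 * p)) < 0 ->
  2 * k * p < e ->
  0 < (p - r) * (k ^+ 2 * p + e * (p + 2 * r)) -> False.
Proof.
rewrite /hugoniot_slope => /andP[e0 er] r0 p0 k0 C A B1 B2.
have B : k ^+ 2 * p + e * (p + 2 * r) < 0.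
  by rewrite -(@nmulr_rgt0 _ (p - r))//; lra.
have ek : e * k < 0 by rewrite pmulr_rlt0.
have [kk|kk] := leP (k ^+ 2) e.
  have pr : 0 < p + r.
    rewrite ltNge; apply/negP => pr.
    have : 0 <= (p + r) * (k ^+ 2 - e) by apply: mulr_le0 => //; lra.
    lra.
  have : 0 <= (k ^+ 2 - e) * p by apply: mulr_le0; lra.
  have : 0 < e * (p + r) by apply: mulr_gt0.
  lra.
have pr : p + r < 0.
  rewrite ltNge; apply/negP => pr.
  have : 0 <= (p + r) * (k ^+ 2 - e) by apply: mulr_ge0 => //; lra.
  lra.
have rp : r ^+ 2 < p ^+ 2.
  have : 0 < (- p - r) * (- p + r) by apply: mulr_gt0; lra.
  lra.
have kp : 0 < k * p by rewrite nmulr_rgt0.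
have : (2 * k * p) ^+ 2 < e ^+ 2 by rewrite ltr_pXn2r// nnegrE; lra.
have : e * r ^+ 2 < k ^+ 2 * p ^+ 2 by apply: ltr_pM => //; try lra; rewrite exprn_gt0.
have : e * e < e * (4 * r ^+ 2) by rewrite ltr_pM2l.
lra.
Qed.

(** The negative slope itself decreases with the density: if [k <= k'], the left side of
    [(p + r) * (e - k ^+ 2) = - 2 * e * k] would strictly grow from [p] to [p'] while the right side
    would not. *)
Lemma hugoniot_slope_neg_mono e r p p' k k' : 0 < e -> 0 < r -> r < p -> p < p' ->
  k < 0 -> k' < 0 -> hugoniot_slope e r p k -> hugoniot_slope e r p' k' ->
  - k * (p - r) < - k' * (p' - r).
Proof.
rewrite /hugoniot_slope => e0 r0 rp pp k0 k0' C C'.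
suff kk : k' < k.
  have : 0 < (k - k') * (p - r) by apply: mulr_gt0; lra.
  have : 0 < (- k') * (p' - p) by apply: mulr_gt0; lra.
  lra.
rewrite ltNge; apply/negP => kk.
have k2 : k' ^+ 2 <= k ^+ 2.
  have : 0 <= (k' - k) * (- k - k') by apply: mulr_ge0; lra.
  lra.
have ek : 0 < e * (- k) by apply: mulr_gt0; lra.
have ke : 0 < e - k ^+ 2.
  rewrite -(@pmulr_rgt0 _ (p + r)); lra.
have : 0 < (p' - p) * (e - k ^+ 2) by apply: mulr_gt0; lra.
have : 0 <= (p' + r) * (k ^+ 2 - k' ^+ 2) by apply: mulr_ge0; lra.
have : 0 <= e * (k' - k) by apply: mulr_ge0; lra.
lra.
Qed.

(* With [T := k (p - r)] the slope equation reads [T^2 - 2 e y T = e x^2] where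
   [x := p - r] and [y := (p - r) / (p + r)] are both increasing in p. *)
Lemma hugoniot_slope_pos_mono e r p p' k k' : 0 < e -> 0 < r -> r < p -> p < p' ->
  0 < k -> 0 < k' -> hugoniot_slope e r p k -> hugoniot_slope e r p' k' ->
  k * (p - r) < k' * (p' - r).
Proof.
rewrite /hugoniot_slope => e0 r0 rp pp k0 k0' C C'.
set T := k * (p - r); set T' := k' * (p' - r).
set y := (p - r) / (p + r); set y' := (p' - r) / (p' + r).
have pr0 : p + r != 0 by rewrite gt_eqF//; lra.
have pr0' : p' + r != 0 by rewrite gt_eqF//; lra.
have E : T * (T - 2 * e * y) = e * (p - r) ^+ 2.
  rewrite /T /y; apply: (mulfI pr0).
  transitivity ((p - r) ^+ 2 * ((p + r) * k ^+ 2 - 2 * e * k)); first by field.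
  by rewrite -C; ring.
have E' : T' * (T' - 2 * e * y') = e * (p' - r) ^+ 2.
  rewrite /T' /y'; apply: (mulfI pr0').
  transitivity ((p' - r) ^+ 2 * ((p' + r) * k' ^+ 2 - 2 * e * k')); first by field.
  by rewrite -C'; ring.
have yy : y < y'.
  rewrite /y /y' ltr_pdivrMr; last lra.
  rewrite mulrAC ltr_pdivlMr; last lra.
  have : 0 < r * (p' - p) by apply: mulr_gt0; lra.
  lra.
have eyy : 0 < e * (y' - y) by apply: mulr_gt0; lra.
have xx : e * (p - r) ^+ 2 < e * (p' - r) ^+ 2.
  by rewrite ltr_pM2l// ltr_pXn2r// ?nnegrE; lra.
have T0 : 0 < T by apply: mulr_gt0; lra.
have T0' : 0 < T' by apply: mulr_gt0; lra.
(* If [T' <= T], then [T * (T - 2 * e * y)] exceeds [T * (T' - 2 * e * y')], which is at least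
   [T' * (T' - 2 * e * y')]. This contradicts [xx]. *)
rewrite ltNge; apply/negP => TT.
have x0' : 0 < e * (p' - r) ^+ 2 by apply: mulr_gt0 => //; apply: exprn_gt0; lra.
have P' : 0 < T' - 2 * e * y' by rewrite -(@pmulr_rgt0 _ T')// E'.
have : 0 <= (T - T') * (T' - 2 * e * y') by apply: mulr_ge0; lra.
have : 0 < T * ((T - 2 * e * y) - (T' - 2 * e * y')) by apply: mulr_gt0; lra.
lra.
Qed.

(** The two sides differ by a multiple of the slope equation. The sign of the result is that of
    [k * (p - r)], and this decides the entropy inequality across the shock. *)
Lemma brio_entropy_jump e r p k a u s :
  hugoniot_slope e r p k -> u = a + k * (p - r) -> s = a + k * p - e ->
  (u ^+ 3 / 3 + (u - e / 2) * e * p ^+ 2) - (a ^+ 3 / 3 + (a - e / 2) * e * r ^+ 2)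
  - s * ((u ^+ 2 / 2 + e / 2 * p ^+ 2) - (a ^+ 2 / 2 + e / 2 * r ^+ 2)) =
  k * (p - r) ^+ 3 * (k ^+ 2 + 3 * e) / 12.
Proof.
rewrite /hugoniot_slope => C -> ->.
transitivity (k * (p - r) ^+ 3 * (k ^+ 2 + 3 * e) / 12
  - (a + k * (p - r) / 2) * (p - r) / 2 * ((p + r) * (k ^+ 2 - e) - 2 * e * k)).
  by field.
by rewrite C; field.
Qed.

End Slope.

(** * The Lax conditions as polynomial inequalities in the slope *)

Section Lax.
Context {R : realType}.
Implicit Types (e r p k a u s D : R).

Lemma lt_sqrt_brio e x y : 0 < e ->
  (`|y| < Num.sqrt (4 * e * x ^+ 2 + e ^+ 2)) = (y ^+ 2 < 4 * e * x ^+ 2 + e ^+ 2).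
Proof.
move=> e0; have h : 0 < 4 * e * x ^+ 2 + e ^+ 2.
  by rewrite ltr_wpDl ?exprn_gt0// mulr_ge0 ?sqr_ge0 ?mulr_ge0 ?(ltW e0).
by rewrite -sqrtr_sqr ltr_sqrt.
Qed.

Lemma sqrt_brio_lt e x y : 0 < e -> (Num.sqrt (4 * e * x ^+ 2 + e ^+ 2) < y) =
  (0 < y) && (4 * e * x ^+ 2 + e ^+ 2 < y ^+ 2).
Proof.
move=> e0; have h : 0 <= 4 * e * x ^+ 2 + e ^+ 2.
  by rewrite addr_ge0 ?sqr_ge0// mulr_ge0 ?sqr_ge0 ?mulr_ge0 ?(ltW e0).
have [y0|y0] /= := ltP 0 y; last first.
  by apply/negbTE; rewrite -leNgt (le_trans y0)// sqrtr_ge0.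
rewrite -[X in _ < X](gtr0_norm y0) -sqrtr_sqr ltr_sqrt//.
by rewrite exprn_gt0.
Qed.

Lemma lax_1shockP e r a u p s : 0 < e -> 0 < r ->
  lax_1shock e (a, r) (u, p) s <->
  exists k, [/\ hugoniot_slope e r p k, u = a + k * (p - r), s = a + k * p - e,
    2 * k * p < e /\ 0 < (p - r) * (k ^+ 2 * p + e * (p + 2 * r)) &
    (r - p) * (k ^+ 2 * r + e * (r + 2 * p)) < 0].
Proof.
move=> e0 r0; rewrite /lax_1shock /brio_lambda1 /brio_lambda2 /rankine_hugoniot /=.
have H k : hugoniot_slope e r p k -> u = a + k * (p - r) -> s = a + k * p - e ->
    [&& s < a - e / 2 - Num.sqrt (4 * e * r ^+ 2 + e ^+ 2) / 2,
        u - e / 2 - Num.sqrt (4 * e * p ^+ 2 + e ^+ 2) / 2 < s &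
        s < u - e / 2 + Num.sqrt (4 * e * p ^+ 2 + e ^+ 2) / 2] =
    [&& 2 * k * p < e, 0 < (p - r) * (k ^+ 2 * p + e * (p + 2 * r)) &
        (r - p) * (k ^+ 2 * r + e * (r + 2 * p)) < 0].
  move=> C uE sE.
  transitivity [&& Num.sqrt (4 * e * r ^+ 2 + e ^+ 2) < e - 2 * k * p &
    `|2 * k * r - e| < Num.sqrt (4 * e * p ^+ 2 + e ^+ 2)].
    rewrite ltr_norml sE uE; congr [&& _, _ & _]; apply/idP/idP; lra.
  rewrite lt_sqrt_brio// sqrt_brio_lt// -andbA subr_gt0; congr [&& _, _ & _].
    rewrite -subr_gt0 -[_ ^+ 2]sqrrN opprB.
    by rewrite (hugoniot_slope_sqr _ _ _ _ (hugoniot_slope_sym _ _ _ _ C)) pmulr_rgt0.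
  by rewrite -subr_lt0 (hugoniot_slope_sqr _ _ _ _ C) pmulr_rlt0.
split.
  move=> [[H1 H2] H3 H4]; have [prE|pr] := eqVneq p r.
    move: H2 H3 H4; rewrite /GRing.scale /= prE => /(rankine_hugoniot_const _ _ _ _ _ r0) -> h1.
    by move=> /andP[h2 _]; move: (lt_trans h1 h2); rewrite ltxx.
  have [k [C uE sE]] := rankine_hugoniot_slope e r p a u s e0 r0 pr H1 H2.
  exists k; move: (H k C uE sE); rewrite H3 H4 => /esym/and3P[h1 h2 h3].
  by split.
move=> [k [C uE sE [h1 h2] h3]].
move: (H k C uE sE); rewrite h1 h2 h3 => /and3P[-> -> ->]; split => //.
rewrite /brio_flux /=; congr pair; rewrite /= /GRing.scale /=.
  move: C; rewrite /hugoniot_slope uE sE => C.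
  apply/eqP; rewrite -subr_eq0.
  rewrite (_ : _ - _ = (p - r) / 2 * ((p + r) * (k ^+ 2 - e) - 2 * e * k)); last by field.
  by rewrite C subrr mulr0.
by rewrite uE sE; ring.
Qed.

(** The slope is anchored at the outer state [(a, r)], now on the right, so both shocks share the
    unknown [(u, p)]. The Rankine-Hugoniot relation is symmetric in the two states. Only the sign of
    [2 * k * p - e] distinguishes the outcome from that of a 1-shock. *)
Lemma lax_2shockP e r a u p s : 0 < e -> 0 < r ->
  lax_2shock e (u, p) (a, r) s <->
  exists k, [/\ hugoniot_slope e r p k, u = a + k * (p - r), s = a + k * p - e,
    e < 2 * k * p /\ 0 < (p - r) * (k ^+ 2 * p + e * (p + 2 * r)) &
    (r - p) * (k ^+ 2 * r + e * (r + 2 * p)) < 0].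
Proof.
move=> e0 r0; rewrite /lax_2shock /brio_lambda1 /brio_lambda2 /rankine_hugoniot /=.
have H k : hugoniot_slope e r p k -> u = a + k * (p - r) -> s = a + k * p - e ->
    [&& a - e / 2 + Num.sqrt (4 * e * r ^+ 2 + e ^+ 2) / 2 < s,
        u - e / 2 - Num.sqrt (4 * e * p ^+ 2 + e ^+ 2) / 2 < s &
        s < u - e / 2 + Num.sqrt (4 * e * p ^+ 2 + e ^+ 2) / 2] =
    [&& e < 2 * k * p, 0 < (p - r) * (k ^+ 2 * p + e * (p + 2 * r)) &
        (r - p) * (k ^+ 2 * r + e * (r + 2 * p)) < 0].
  move=> C uE sE.
  transitivity [&& Num.sqrt (4 * e * r ^+ 2 + e ^+ 2) < 2 * k * p - e &
    `|2 * k * r - e| < Num.sqrt (4 * e * p ^+ 2 + e ^+ 2)].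
    rewrite ltr_norml sE uE; congr [&& _, _ & _]; apply/idP/idP; lra.
  rewrite lt_sqrt_brio// sqrt_brio_lt// -andbA subr_gt0; congr [&& _, _ & _].
    rewrite -subr_gt0.
    by rewrite (hugoniot_slope_sqr _ _ _ _ (hugoniot_slope_sym _ _ _ _ C)) pmulr_rgt0.
  by rewrite -subr_lt0 (hugoniot_slope_sqr _ _ _ _ C) pmulr_rlt0.
split.
  move=> [[+ +] H3 H4]; rewrite /GRing.scale /= => H1' H2'.
  have H1 : s * (u - a) = u ^+ 2 / 2 + e / 2 * p ^+ 2 - (a ^+ 2 / 2 + e / 2 * r ^+ 2) by lra.
  have H2 : s * (p - r) = p * u - e * p - (r * a - e * r) by lra.
  have [prE|pr] := eqVneq p r.
    move: H2 H3 H4; rewrite prE => /(rankine_hugoniot_const _ _ _ _ _ r0) -> h1.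
    by move=> /andP[h2 h3]; move: (lt_trans h1 h3); rewrite ltxx.
  have [k [C uE sE]] := rankine_hugoniot_slope e r p a u s e0 r0 pr H1 H2.
  exists k; move: (H k C uE sE); rewrite H3 H4 => /esym/and3P[h1 h2 h3].
  by split.
move=> [k [C uE sE [h1 h2] h3]].
move: (H k C uE sE); rewrite h1 h2 h3 => /and3P[-> -> ->]; split => //.
rewrite /brio_flux /=; congr pair; rewrite /= /GRing.scale /=.
  move: C; rewrite /hugoniot_slope uE sE => C.
  apply/eqP; rewrite -subr_eq0.
  rewrite (_ : _ - _ = - (p - r) / 2 * ((p + r) * (k ^+ 2 - e) - 2 * e * k)); last by field.
  by rewrite C subrr mulr0.
by rewrite uE sE; ring.
Qed.
End Lax.

(** * The intermediate state: characterization, uniqueness and existence *)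

Section TwoShock.
Context {R : realType}.
Implicit Types (e r p k M ul ur rl rr : R).

Lemma lax_two_shockP e ul rl ur rr (Um : R * R) s1 s2 :
  0 < e < 4 * rl ^+ 2 -> 0 < rl -> 0 < rr ->
  lax_two_shock e (ul, rl) (ur, rr) Um s1 s2 <->
  exists p k1 k2,
    [/\ [/\ rl < p, rr < p, k1 < 0 & 0 < k2],
        hugoniot_slope e rl p k1 /\ hugoniot_slope e rr p k2,
        Um = (ul + k1 * (p - rl), p),
        ul - ur = - k1 * (p - rl) + k2 * (p - rr) &
        s1 = ul + k1 * p - e /\ s2 = ur + k2 * p - e].
Proof.
move=> /[dup] e4 /andP[e0 _] rl0 rr0; case: Um => um p; split.
  move=> [/(lax_1shockP _ _ _ _ _ _ e0 rl0) [k1 [C1 u1 s1E [B1 B1'] A1]]].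
  move=> /(lax_2shockP _ _ _ _ _ _ e0 rr0) [k2 [C2 u2 s2E [B2 B2'] A2]] s12.
  (* Since [s1 = um + k1 * rl - e] and [s2 = um + k2 * rr - e], the condition [s1 < s2] means
     [k1 * rl < k2 * rr]. A negative [p] makes [k2] negative, hence also [k1], the case excluded
     above. *)
  have p0 : 0 < p.
    rewrite ltNge le_eqVlt; apply/negP => /predU1P[p0|p0].
      by move: B2; rewrite p0 mulr0 ltNge (ltW e0).
    have k20 : k2 < 0.
      rewrite -(nmulr_lgt0 _ p0); lra.
    have k10 : k1 < 0.
      have : k1 * rl < 0.
        have : k2 * rr < 0 by rewrite nmulr_rlt0.
        move: s12; rewrite s1E s2E; move: u1; rewrite u2; lra.
      by rewrite pmulr_llt0.
    exact: (hugoniot_slope_excluded e rl p k1).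
  have rlp := hugoniot_slope_lt_mid _ _ _ _ e0 rl0 p0 A1.
  have rrp := hugoniot_slope_lt_mid _ _ _ _ e0 rr0 p0 A2.
  exists p, k1, k2; split => //.
  - split => //; first exact: hugoniot_slope_lt0 C1 B1.
    by rewrite -(pmulr_lgt0 _ p0); lra.
  - by rewrite u1.
  - by move: u1; rewrite u2; lra.
move=> [q [k1 [k2 [[rlp rrp k10 k20] [C1 C2] [umE pE] ulr [s1E s2E]]]]].
(* Conversely, the slope equation yields [2 * e < k2 * (p + rr)], and [rr < p] turns this into the
   Lax bound [k2p]. *)
subst q; have p0 : 0 < p by lra.
have k1p : k1 * p < 0 by rewrite nmulr_rlt0.
have k2p : e < 2 * k2 * p.
  have : 0 < k2 * (k2 * (p + rr) - 2 * e).
    have : 0 < e * (p + rr) by apply: mulr_gt0 => //; lra.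
    by move: C2; rewrite /hugoniot_slope; lra.
  rewrite pmulr_rgt0// => h.
  have : 0 < k2 * (p - rr) by apply: mulr_gt0 => //; lra.
  lra.
have A k r : 0 < r -> r < p -> (r - p) * (k ^+ 2 * r + e * (r + 2 * p)) < 0.
  move=> r0 rp; rewrite nmulr_rlt0; last lra.
  apply: ltr_wpDl; first by rewrite mulr_ge0 ?sqr_ge0 ?(ltW r0).
  by apply: mulr_gt0 => //; lra.
have B k r : 0 < r -> r < p -> 0 < (p - r) * (k ^+ 2 * p + e * (p + 2 * r)).
  move=> r0 rp; rewrite pmulr_rgt0; last lra.
  apply: ltr_wpDl; first by rewrite mulr_ge0 ?sqr_ge0 ?(ltW p0).
  by apply: mulr_gt0 => //; lra.
split.
- apply/lax_1shockP => //; exists k1; split => //; last exact: A.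
  by split; [lra | exact: B].
- apply/lax_2shockP => //; exists k2; split => //; last exact: A.
    lra.
  by split; [lra | exact: B].
- have : k1 * rl < 0 by rewrite nmulr_rlt0.
  have : 0 < k2 * rr by rewrite mulr_gt0.
  by rewrite s1E s2E; lra.
Qed.

(** As a quadratic in [k] the slope equation has root product [- e], so it has at most one root of
    each sign. *)
Lemma hugoniot_slope_inj e r p k k' : 0 < e -> 0 < p + r -> 0 < k * k' ->
  hugoniot_slope e r p k -> hugoniot_slope e r p k' -> k = k'.
Proof.
rewrite /hugoniot_slope => e0 pr kk C C'.
have : (k - k') * ((p + r) * (e + k * k')) = 0.
  transitivity (k * (2 * e * k' - (p + r) * (k' ^+ 2 - e)) -
                k' * (2 * e * k - (p + r) * (k ^+ 2 - e))); first ring.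
  by rewrite C C'; ring.
move=> /eqP; rewrite mulf_eq0 subr_eq0 => /orP[/eqP//|].
by rewrite gt_eqF// mulr_gt0// addr_gt0.
Qed.

Lemma lax_two_shock_unique e ul rl ur rr (Um Um' : R * R) s1 s2 s1' s2' :
  0 < e < 4 * rl ^+ 2 -> 0 < rl -> 0 < rr ->
  lax_two_shock e (ul, rl) (ur, rr) Um s1 s2 ->
  lax_two_shock e (ul, rl) (ur, rr) Um' s1' s2' ->
  [/\ Um = Um', s1 = s1' & s2 = s2'].
Proof.
move=> e4 rl0 rr0; have /andP[e0 _] := e4.
move=> /(lax_two_shockP _ _ _ _ _ _ _ _ e4 rl0 rr0).
move=> [p [k1 [k2 [[rlp rrp k10 k20] [C1 C2] -> D [-> ->]]]]].
move=> /(lax_two_shockP _ _ _ _ _ _ _ _ e4 rl0 rr0).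
move=> [p' [k1' [k2' [[rlp' rrp' k10' k20'] [C1' C2'] -> D' [-> ->]]]]].
have pp : p = p'.
  have [pp|pp|//] := ltgtP p p'.
    have := hugoniot_slope_neg_mono _ _ _ _ _ _ e0 rl0 rlp pp k10 k10' C1 C1'.
    have := hugoniot_slope_pos_mono _ _ _ _ _ _ e0 rr0 rrp pp k20 k20' C2 C2'.
    lra.
  have := hugoniot_slope_neg_mono _ _ _ _ _ _ e0 rl0 rlp' pp k10' k10 C1' C1.
  have := hugoniot_slope_pos_mono _ _ _ _ _ _ e0 rr0 rrp' pp k20' k20 C2' C2.
  lra.
subst p'.
have -> : k1 = k1' by apply: (hugoniot_slope_inj e rl p) => //; [lra|rewrite nmulr_rgt0].
have -> : k2 = k2' by apply: (hugoniot_slope_inj e rr p) => //; [lra|rewrite pmulr_rgt0].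
by [].
Qed.

(** The square root of the reduced discriminant of the slope equation [(p + r) * k ^+ 2 - 2 * e * k
    - e * (p + r) = 0]. *)
Definition slope_disc e r p : R := Num.sqrt (e ^+ 2 + e * (p + r) ^+ 2).

Lemma slope_disc_sqr e r p : 0 < e ->
  slope_disc e r p ^+ 2 = e ^+ 2 + e * (p + r) ^+ 2.
Proof.
by move=> e0; rewrite sqr_sqrtr// addr_ge0 ?sqr_ge0// mulr_ge0 ?sqr_ge0 ?(ltW e0).
Qed.

Lemma slope_disc_gt e r p : 0 < e -> 0 < p + r -> e < slope_disc e r p.
Proof.
move=> e0 pr; rewrite -(@ltr_pXn2r _ 2)// ?nnegrE ?sqrtr_ge0 ?(ltW e0)//.
by rewrite slope_disc_sqr// ltrDl mulr_gt0// exprn_gt0.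
Qed.

Lemma slope_disc_le e r p M : 0 < e -> e < 1 -> 0 < p + r -> p + r <= M ->
  slope_disc e r p <= Num.sqrt e * (1 + M).
Proof.
move=> e0 e1 pr prM.
rewrite -(@ler_pXn2r _ 2)// ?nnegrE ?sqrtr_ge0// ?mulr_ge0 ?sqrtr_ge0//; try lra.
rewrite slope_disc_sqr// exprMn sqr_sqrtr ?(ltW e0)//.
have : e ^+ 2 <= e by rewrite expr2 ger_pMl// ltW.
have : e * (p + r) ^+ 2 <= e * M ^+ 2.
  by rewrite ler_pM2l// ler_pXn2r// nnegrE; lra.
have : 0 < e * M by apply: mulr_gt0; lra.
lra.
Qed.

Lemma hugoniot_slope_neg_root e r p : 0 < e -> 0 < p + r ->
  let k := (e - slope_disc e r p) / (p + r) in hugoniot_slope e r p k /\ k < 0.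
Proof.
move=> e0 pr k; split; last first.
  by rewrite pmulr_llt0 ?invr_gt0// subr_lt0 slope_disc_gt.
have pr0 : p + r != 0 by rewrite gt_eqF.
rewrite /hugoniot_slope /k.
transitivity ((e ^+ 2 - 2 * e * slope_disc e r p + slope_disc e r p ^+ 2
   - e * (p + r) ^+ 2) / (p + r)); first by field.
by rewrite slope_disc_sqr//; field.
Qed.

Lemma hugoniot_slope_pos_root e r p : 0 < e -> 0 < p + r ->
  let k := (e + slope_disc e r p) / (p + r) in hugoniot_slope e r p k /\ 0 < k.
Proof.
move=> e0 pr k; split; last first.
  by rewrite divr_gt0// addr_gt0// (lt_trans e0)// slope_disc_gt.
have pr0 : p + r != 0 by rewrite gt_eqF.
rewrite /hugoniot_slope /k.
transitivity ((e ^+ 2 + 2 * e * slope_disc e r p + slope_disc e r p ^+ 2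
   - e * (p + r) ^+ 2) / (p + r)); first by field.
by rewrite slope_disc_sqr//; field.
Qed.

Lemma continuous_slope_disc e r : continuous (slope_disc e r).
Proof.
move=> p; apply: (@continuous_comp _ _ _ (fun p => e ^+ 2 + e * (p + r) ^+ 2) Num.sqrt).
  apply: cvgD; first exact: cvg_cst.
  apply: cvgM; first exact: cvg_cst.
  apply: (@continuous_comp _ _ _ (fun p => p + r) (fun x => x ^+ 2)).
    by apply: cvgD; [exact: cvg_id | exact: cvg_cst].
  exact: exprn_continuous.
exact: sqrt_continuous.
Qed.

(** The intermediate value theorem, applied to the velocity jump [G] on [[M, P]], yields the
    intermediate density. *)
Lemma lax_two_shock_exists ul rl ur rr e : ur < ul -> 0 < rl -> 0 < rr ->
  let M := Num.max rl rr in
  0 < e -> e < 1 -> e < 4 * rl ^+ 2 -> e < ((ul - ur) / (3 + 4 * M)) ^+ 2 ->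
  exists Um s1 s2, lax_two_shock e (ul, rl) (ur, rr) Um s1 s2.
Proof.
move=> ulr rl0 rr0 M e0 e1 e4 eD.
have rlM : rl <= M by rewrite le_max lexx.
have rrM : rr <= M by rewrite le_max lexx orbT.
set c := Num.sqrt e; have c0 : 0 < c by rewrite sqrtr_gt0.
have cc : c ^+ 2 = e by rewrite sqr_sqrtr// ltW.
pose kl p := (e - slope_disc e rl p) / (p + rl).
pose kr p := (e + slope_disc e rr p) / (p + rr).
pose G p := - kl p * (p - rl) + kr p * (p - rr).
(* The constant bounds [G M]: the factors [(M - r) / (M + r)] are at most 1, each [slope_disc] is at
   most [c * (1 + 2 * M)], and the remaining [e] is at most [c]. *)
have cD : c * (3 + 4 * M) < ul - ur.
  rewrite -ltr_pdivlMr; last lra.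
  rewrite -(@ltr_pXn2r _ 2)// ?nnegrE ?(ltW c0) ?cc//.
  by apply: divr_ge0; lra.
have GM : G M < ul - ur.
  apply: le_lt_trans cD; rewrite /G /kl /kr.
  have hl := slope_disc_le e rl M (2 * M) e0 e1 ltac:(lra) ltac:(lra).
  have hr := slope_disc_le e rr M (2 * M) e0 e1 ltac:(lra) ltac:(lra).
  have dl := slope_disc_gt e rl M e0 ltac:(lra).
  have dr := slope_disc_gt e rr M e0 ltac:(lra).
  have ec : e <= c.
    by rewrite -cc expr2 ger_pMl// -(sqrtr1 R) ler_wsqrtr// ltW.
  have y r : 0 < r -> r <= M -> 0 <= (M - r) / (M + r) <= 1.
    move=> r0 rM; rewrite ler_pdivrMr; last lra.
    by apply/andP; split; [apply: divr_ge0; lra | lra].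
  have /andP[yl0 yl1] := y rl rl0 rlM.
  have /andP[yr0 yr1] := y rr rr0 rrM.
  rewrite -mulNr mulrAC [X in _ + X]mulrAC -!mulrA.
  set yl := (M - rl) / (M + rl) in yl0 yl1 *.
  set yr := (M - rr) / (M + rr) in yr0 yr1 *.
  have : - (e - slope_disc e rl M) * yl <= slope_disc e rl M.
    have : 0 <= (slope_disc e rl M - e) * (1 - yl) by apply: mulr_ge0; lra.
    lra.
  have : (e + slope_disc e rr M) * yr <= e + slope_disc e rr M.
    have : 0 <= (slope_disc e rr M + e) * (1 - yr) by apply: mulr_ge0; lra.
    lra.
  rewrite -/c in hl hr.
  lra.
(* The positive slope is at least [c], so the right-hand shock alone contributes at least
   [c * (P - M) = ul - ur] to [G P]. *)
pose P := M + (ul - ur) / c.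
have DP : 0 < (ul - ur) / c by apply: divr_gt0; lra.
have MP : M <= P by rewrite /P; lra.
have GP : ul - ur <= G P.
  have [Cl kl0] := hugoniot_slope_neg_root e rl P e0 ltac:(lra).
  have [Cr kr0] := hugoniot_slope_pos_root e rr P e0 ltac:(lra).
  rewrite -/(kl P) in Cl kl0; rewrite -/(kr P) in Cr kr0.
  have kc : c <= kr P.
    rewrite -(@ler_pXn2r _ 2)// ?nnegrE ?(ltW c0) ?(ltW kr0)// cc.
    rewrite -subr_ge0 -(@pmulr_rge0 _ (P + rr)); last lra.
    move: Cr; rewrite /hugoniot_slope => ->. apply: mulr_ge0; [lra | exact: ltW].
  have : 0 <= - kl P * (P - rl) by apply: mulr_ge0; lra.
  have : 0 <= (kr P - c) * (P - rr) by apply: mulr_ge0; lra.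
  have : 0 <= c * (M - rr) by apply: mulr_ge0; lra.
  have : c * (P - M) = ul - ur by rewrite /P; field; rewrite gt_eqF.
  rewrite /G; lra.
have cG : {within `[M, P], continuous G}.
  apply: continuous_in_subspaceT => p; rewrite inE /= in_itv /= => /andP[Mp _].
  have cdiv r : 0 < r -> (fun p => (p + r)^-1) @ p --> (p + r)^-1.
    move=> r0; apply: cvgV; first by rewrite gt_eqF//; lra.
    by apply: cvgD; [exact: cvg_id | exact: cvg_cst].
  have csub r : (fun p => p - r) @ p --> p - r.
    by apply: cvgB; [exact: cvg_id | exact: cvg_cst].
  apply: cvgD; apply: cvgM => //.
    apply: cvgN; apply: cvgM; last exact: cdiv.
    by apply: cvgB; [exact: cvg_cst | exact: continuous_slope_disc].
  apply: cvgM; last exact: cdiv.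
  by apply: cvgD; [exact: cvg_cst | exact: continuous_slope_disc].
have GMP : Num.min (G M) (G P) <= ul - ur <= Num.max (G M) (G P).
  by rewrite ge_min le_max (ltW GM) GP /= orbT.
have [p] := IVT MP cG GMP.
rewrite in_itv /= => /andP[Mp _] Gp.
(* The strict inequality [GM] keeps [p] off the endpoint [M], where one of the two shocks would
   degenerate. *)
have Mp' : M < p by rewrite lt_neqAle Mp andbT; apply/eqP => E; move: Gp GM; rewrite E; lra.
have [Cl kl0] := hugoniot_slope_neg_root e rl p e0 ltac:(lra).
have [Cr kr0] := hugoniot_slope_pos_root e rr p e0 ltac:(lra).
exists (ul + kl p * (p - rl), p), (ul + kl p * p - e), (ur + kr p * p - e).
apply/lax_two_shockP => //; first by rewrite e0.
exists p, (kl p), (kr p); split => //.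
by split => //; [exact: le_lt_trans Mp' | exact: le_lt_trans Mp'].
Qed.

End TwoShock.

(** * Integration over the plane *)

Section PlaneMeasure.
Context {R : realType}.
Local Notation TR := (measurableTypeR R).
Local Notation mu := (@lebesgue_measure R).

Lemma open_prod_measurable (A : set (R * R)) :
  open A -> measurable (A : set (TR * TR)).
Proof.
move=> oA.
pose box (i : (rat * rat) * (rat * rat)) : set (TR * TR) :=
  `](ratr i.1.1), (ratr i.1.2)[%classic `*` `](ratr i.2.1), (ratr i.2.2)[%classic.
(* Rational boxes not contained in [A] are replaced by the empty set, so the union runs over a whole
   countable type. *)
pose F i := if `[< box i `<=` A >] then box i else set0.
have -> : A = \bigcup_i F i.
  apply/seteqP; split => [p Ap|p [i _]]; last first.
    by rewrite /F; case: asboolP => // h /h.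
  have /nbhs_ballP[e /= e0 eA] : nbhs p A by apply: open_nbhs_nbhs.
  have pick (x : R) : exists a b : rat, [/\ x - e < ratr a, ratr a < x, x < ratr b & ratr b < x + e].
    have [a] := @rat_in_itvoo R (x - e) x ltac:(lra).
    have [b] := @rat_in_itvoo R x (x + e) ltac:(lra).
    by rewrite !in_itv /= => /andP[? ?] /andP[? ?]; exists a, b.
  have [a [b [a1 a2 b1 b2]]] := pick p.1.
  have [c [d [c1 c2 d1 d2]]] := pick p.2.
  exists ((a, b), (c, d)) => //; rewrite /F.
  case: asboolP; first by rewrite /box /= !in_itv /= a2 b1 c2 d1.
  case; move=> q; rewrite /box /= !in_itv /= => -[/andP[q1 q2] /andP[q3 q4]].
  apply: eA; split; rewrite /ball /= ltr_norml; lra.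
apply: countable_bigcupT_measurable => // i; rewrite /F.
by case: asboolP => // _; apply: measurableX; exact: measurable_itv.
Qed.

Lemma continuous_measurable_fun_plane (f : R * R -> R) :
  continuous f -> measurable_fun setT (f : TR * TR -> R).
Proof.
move=> /continuousP cf; apply: (measurability _ (RGenOpens.measurableE R)).
move=> _ [_ [a [b ->] <-]]; rewrite setTI.
by apply: open_prod_measurable; apply: cf; exact: interval_open.
Qed.

(** A bounded measurable function vanishing outside a square of finite measure is integrable. This
    supplies the integrability needed for Fubini. *)
Lemma compact_support_integrable (g : R * R -> R) (K : set (R * R))
    (A : set (TR * TR)) :
  continuous g -> compact K -> (forall p, ~ K p -> g p = 0) -> measurable A ->
  (mu \x mu)%E.-integrable setT (fun p : TR * TR => (g p * \1_A p)%:E).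
Proof.
move=> cg cK gK mA.
have mgA : measurable_fun setT (fun p : TR * TR => g p * \1_A p).
  apply: measurable_funM; first exact: continuous_measurable_fun_plane.
  exact: measurable_indic.
have [M [_ HM]] := compact_bounded cK.
have [N [_ HN]] := compact_bounded (continuous_compact (continuous_subspaceT cg) cK).
have KM p : K p -> `|p| <= `|M| + 1.
  by move=> Kp; apply: HM => //; rewrite (le_lt_trans (ler_norm _))// ltrDl.
have gN p : `|g p| <= `|N| + 1.
  have [Kp|nKp] := pselect (K p); last by rewrite (gK _ nKp) normr0 addr_ge0.
  by apply: HN; [rewrite (le_lt_trans (ler_norm _))// ltrDl | exists p].
pose C : R := `|M| + 1.
pose I : set TR := `[- C, C]%classic.
pose B : set (TR * TR) := I `*` I.
have mB : measurable B by apply: measurableX; exact: measurable_itv.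
have KB : K `<=` B.
  move=> p /KM; rewrite prod_normE ge_max => /andP[h1 h2].
  by rewrite /B /I /= !in_itv /= -!ler_norml.
have iB : (mu \x mu)%E.-integrable B (EFin \o (fun p : TR * TR => g p * \1_A p)).
  apply: measurable_bounded_integrable => //.
  - rewrite [X in (X < _)%E](_ : _ = (mu I * mu I)%E); last first.
      by apply: product_measure1E; exact: measurable_itv.
    by rewrite !lebesgue_measure_itv /=; case: ifPn => _; rewrite ?mul0e// -EFinD -EFinM ltry.
  - exact: measurable_funTS.
  - exists (`|N| + 1); split; first exact: num_real.
    move=> x Nx p _ /=; rewrite normrM (le_trans _ (ltW Nx))// -[leRHS]mulr1.
    by apply: ler_pM => //; rewrite indicE; case: (_ \in _); rewrite ?normr1 ?normr0.
move/(integrable_mkcond _ mB) : iB; apply: eq_integrable => // p _.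
rewrite patchE; case: ifPn => // /negP nB.
rewrite gK ?mul0r// => /KB Bp; apply: nB; exact: mem_set.
Qed.

Lemma ge0_integral_translate (f : TR -> \bar R) (c : R) :
  measurable_fun setT f -> (forall x, 0 <= f x)%E ->
  (\int[mu]_x f x = \int[mu]_x f (x + c)%R)%E.
Proof.
move=> mf f0.
pose tr : TR -> TR := fun x : R => x + c.
have mc : measurable_fun setT tr.
  by apply: continuous_measurable_fun => x; apply: cvgD; [exact: cvg_id | exact: cvg_cst].
transitivity (\int[pushforward mu tr]_x f x)%E.
  (* The translated measure agrees with Lebesgue measure on half-open intervals, hence everywhere by
     uniqueness. *)
  apply: eq_measure_integral => A mA _.
  apply: lebesgue_measure_unique => //= _ [[a b]] _ <-.
  rewrite /pushforward.
  have -> : tr @^-1` `]a, b] = `](a - c), (b - c)]%classic.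
    apply/seteqP; split => x; rewrite /tr /= !in_itv /= => /andP[? ?]; apply/andP; split; lra.
  rewrite !lebesgue_measure_itv /= !lte_fin ltrD2r; case: ifPn => // _.
  by congr EFin; ring.
by rewrite ge0_integral_pushforward.
Qed.

Lemma integral_translate (f : TR -> \bar R) (c : R) : measurable_fun setT f ->
  (\int[mu]_x f x = \int[mu]_x f (x + c)%R)%E.
Proof.
move=> mf; rewrite integralE [RHS]integralE.
rewrite (ge0_integral_translate _ c (measurable_funepos mf))//.
rewrite (ge0_integral_translate _ c (measurable_funeneg mf))//.
by congr (_ - _)%E; apply: eq_integral => x _;
  rewrite -[LHS]/((_ \o (fun x => x + c)) x) -?funepos_comp -?funeneg_comp.
Qed.

(* A compactly supported antiderivative makes both boundary terms at infinity vanish. *)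
Lemma integral_compact_FTC (f F : R -> R) (B c : R) :
  continuous f -> (forall x : R, is_derive x (1 : R) F (f x)) ->
  (forall x, B < `|x| -> F x = 0) -> (forall x, B < `|x| -> f x = 0) ->
  (\int[mu]_x (f x * (x < c)%R%:R)%:E = (F c)%:E)%E.
Proof.
move=> cf dF F0 f0.
pose a : R := - `|B| - `|c| - 1.
have Ba (x : R) : x <= a -> B < `|x|.
  move=> xa; have := ler_norm B; have := ler_norm (- x); rewrite normrN.
  have := normr_ge0 c; rewrite /a in xa; lra.
have ac : a < c.
  by have := normr_ge0 B; have := ler_norm (- c); rewrite normrN /a; lra.
transitivity (\int[mu]_(x in `[a, c[) (f x)%:E)%E.
  rewrite [RHS]integral_mkcond; apply: eq_integral => x _.
  rewrite patchE; have [xI|xI] := boolP (x \in _).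
    by move: xI; rewrite inE /= in_itv /= => /andP[_ ->]; rewrite mulr1.
  congr EFin; have [xc|xc] := ltP x c; last by rewrite mulr0.
  rewrite f0 ?mul0r//; apply: Ba; rewrite leNgt; apply/negP => ax.
  by move/negP: xI; apply; rewrite inE /= in_itv /= (ltW ax) xc.
rewrite integral_itv_bndo_bndc; last first.
  apply: measurable_funTS; apply/measurable_EFinP.
  exact: continuous_measurable_fun.
have cF : continuous F.
  move=> x; apply: differentiable_continuous; apply/derivable1_diffP.
  by have [] := dF x.
rewrite (continuous_FTC2 ac (F := F)).
- by rewrite (F0 a (Ba _ (lexx _))) sube0.
- exact: continuous_subspaceT.
- split; first by move=> x _; have [] := dF x.
    by apply: cvg_at_right_filter; exact: cF.
  by apply: cvg_at_left_filter; exact: cF.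
- by move=> x _; rewrite derive1E; have [] := dF x.
Qed.

Lemma integral_compact_FTC0 (f F : R -> R) (B : R) :
  continuous f -> (forall x : R, is_derive x (1 : R) F (f x)) ->
  (forall x, B < `|x| -> F x = 0) -> (forall x, B < `|x| -> f x = 0) ->
  (\int[mu]_x (f x)%:E = 0)%E.
Proof.
(* With [c] beyond the support, the cutoff [x < c] changes nothing and [F c] vanishes. *)
move=> cf dF F0 f0; pose c : R := `|B| + 1.
have Bc (x : R) : c <= x -> B < `|x|.
  by have := ler_norm B; have := ler_norm x; rewrite /c; lra.
rewrite -[RHS](_ : (F c)%:E = _); last by rewrite F0 ?Bc.
rewrite -(integral_compact_FTC f F B c)//; apply: eq_integral => x _.
have [xc|xc] := ltP x c; first by rewrite mulr1.
by rewrite f0 ?mul0r ?Bc.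
Qed.

Lemma is_derive_line (phi : R * R -> R) (p v : R * R) (t : R) :
  differentiable phi (p + t *: v) ->
  is_derive t (1 : R) (fun t : R => phi (p + t *: v)) ('D_v phi (p + t *: v)).
Proof.
move=> d; have dv : derivable phi (p + t *: v) v by exact: diff_derivable.
have E : (fun h => h^-1 *: (((fun t : R => phi (p + t *: v)) \o shift t) (h *: 1)
      - phi (p + t *: v))) =
    (fun h => h^-1 *: ((phi \o shift (p + t *: v)) (h *: v) - phi (p + t *: v))).
  apply/funext => h /=; congr (_ *: (phi _ - _)).
  by rewrite [h *: 1]mulr1 scalerDl addrCA.
by split; [rewrite /derivable E | rewrite /derive E].
Qed.

End PlaneMeasure.

(** * The weak entropy inequality *)

Lemma continuous_pair {R : realType} (T : topologicalType) (f g : T -> R) :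
  continuous f -> continuous g -> continuous (fun x => (f x, g x)).
Proof. by move=> cf cg x; apply: cvg_pair (cf x) (cg x). Qed.

Section TestFunction.
Context {R : realType}.
Local Notation TR := (measurableTypeR R).
Local Notation mu := (@lebesgue_measure R).
Context (phi : R * R -> R) (test : nonneg_test_function phi).

Let K := closure [set p | phi p != 0].
Let P := 'D_((1, 0) : R * R) phi.
Let Q := 'D_((0, 1) : R * R) phi.

Let phi_diff p : differentiable phi p.
Proof. by have [/(_ 1%N)[]] := test. Qed.

Let cphi : continuous phi.
Proof. by move=> p; exact: differentiable_continuous. Qed.

Let cP : continuous P.
Proof. by have [/(_ 1%N)[]] := test. Qed.

Let cQ : continuous Q.
Proof. by have [/(_ 1%N)[]] := test. Qed.

Let cK : compact K.
Proof. by have [] := test. Qed.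

Let phi_out p : ~ K p -> phi p = 0.
Proof.
by move=> nK; apply/eqP/negPn/negP => h; apply: nK; exact: subset_closure.
Qed.

Let D_out v p : ~ K p -> 'D_v phi p = 0.
Proof.
move=> nK.
have nearK : \forall q \near p, phi q = 0.
  have : nbhs p (~` K).
    by apply: open_nbhs_nbhs; split => //; apply: closed_openC; exact: closed_closure.
  by apply: filterS => q; exact: phi_out.
have -> : 'D_v phi p = 'D_v (cst 0 : R * R -> R) p by exact: near_eq_derive.
exact: derive_cst.
Qed.

Let D_shear s p : 'D_((s, 1) : R * R) phi p = Q p + s * P p.
Proof.
have -> : ((s, 1) : R * R) = (0, 1) + s *: (1, 0).
  by congr pair; rewrite /= /GRing.scale /= ?mulr1 ?mulr0 ?add0r ?addr0.
by rewrite /Q /P !deriveE// linearD linearZ.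
Qed.

Let bounded_outside : exists B : R, forall x t, B < `|x| \/ B < `|t| -> ~ K (x, t).
Proof.
have [M [_ HM]] := compact_bounded cK.
exists (`|M| + 1) => x t xt Kp.
have : `|(x, t) : R * R| <= `|M| + 1.
  by apply: HM => //; rewrite (le_lt_trans (ler_norm _))// ltrDl.
rewrite prod_normE /= ge_max => /andP[h1 h2].
by case: xt; rewrite ltNge ?h1 ?h2.
Qed.

(* In the sheared coordinates [(x - s t, t)] the derivative along [(s, 1)] is a
   pure time derivative. *)
Lemma integral_shear_derivative (s : R) (Y : set TR) : measurable Y ->
  (mu \x mu)%E.-integrable setT (fun p : TR * TR =>
     ((Q p + s * P p) * \1_([set p : TR * TR | Y (p.1 - s * p.2)]) p)%:E) /\
  (\int[mu \x mu]_p
     ((Q p + s * P p) * \1_([set p : TR * TR | Y (p.1 - s * p.2)%R]) p)%:E = 0)%E.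
Proof.
move=> mY; set A := [set p | _].
pose sh : R * R -> R * R := fun p => (p.1 - s * p.2, p.2).
pose ush : R * R -> R * R := fun p => (p.1 + s * p.2, p.2).
have csh : continuous sh.
  apply: continuous_pair => p; last exact: cvg_snd.
  apply: cvgB; first exact: cvg_fst.
  by apply: cvgM; [exact: cvg_cst | exact: cvg_snd].
have cush : continuous ush.
  apply: continuous_pair => p; last exact: cvg_snd.
  apply: cvgD; first exact: cvg_fst.
  by apply: cvgM; [exact: cvg_cst | exact: cvg_snd].
have mA : measurable A.
  have msh : measurable_fun setT (fun p : TR * TR => (sh p).1 : TR).
    apply: continuous_measurable_fun_plane => p.
    exact: (continuous_comp (csh p) (@cvg_fst _ _ _ _ _)).
  by rewrite -[A]setTI; exact: msh.
pose h p := Q p + s * P p.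
have ch : continuous h.
  by move=> p; apply: cvgD; [exact: cQ | apply: cvgM; [exact: cvg_cst | exact: cP]].
have h_out p : ~ K p -> h p = 0.
  by move=> nK; rewrite /h /Q /P !D_out// mulr0 addr0.
have int_f := compact_support_integrable h K A ch cK h_out mA.
have mf : measurable_fun setT (fun p : TR * TR => (h p * \1_A p)%:E).
  exact: measurable_int int_f.
split; first exact: int_f.
rewrite -(integral21_prod_meas1 int_f) /fubini_G.
(* After the shear the region is the product of [Y] with the whole time axis, so the time integral
   can be taken first, at fixed sheared position. *)
pose g : TR * TR -> \bar R := fun p => (h (ush p) * \1_(Y `*` setT) p)%:E.
have int_g : (mu \x mu)%E.-integrable setT g.
  apply: (compact_support_integrable (h \o ush) (sh @` K)).
  - by move=> p; apply: continuous_comp; [exact: cush | exact: ch].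
  - by apply: continuous_compact => //; exact: continuous_subspaceT.
  - move=> p nKp; apply: h_out => Kp; apply: nKp; exists (ush p) => //.
    by rewrite /sh /ush /= addrK; case: p Kp.
  - exact: measurableX.
transitivity (\int[mu]_t \int[mu]_y g (y, t))%E.
  apply: eq_integral => t _.
  have mft : measurable_fun setT (fun x : TR => (h (x, t) * \1_A (x, t))%:E).
    exact: measurable_fun_pair1 mf.
  rewrite (integral_translate _ (s * t) mft).
  apply: eq_integral => y _; rewrite /g /ush /=; congr (_ * _)%:E.
  rewrite !indicE; congr (_ %:R); congr nat_of_bool.
  apply/idP/idP; rewrite !inE /A /= addrK; first by split.
  by case.
rewrite -(Fubini int_g); apply: integral0_eq => y _.
have [B HB] := bounded_outside.
rewrite /g; have [yY|yY] := pselect (Y y); last first.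
  apply: integral0_eq => t _; rewrite indicE memNset ?mulr0//.
  by case.
have lineE t : ush (y, t) = (y, 0) + t *: ((s, 1) : R * R).
  by rewrite /ush /=; congr pair; rewrite /= /GRing.scale /= ?mulr1 ?add0r// mulrC.
have out t : B < `|t| -> ~ K (ush (y, t)) by move=> Bt; apply: HB; right.
rewrite -[RHS](@integral_compact_FTC0 R (fun t => h (ush (y, t)))
   (fun t => phi (ush (y, t))) B).
- apply: eq_integral => t _; rewrite indicE mem_set ?mulr1//.
- move=> t; apply: (@continuous_comp _ _ _ (fun t : R => ush (y, t)) h); last exact: ch.
  apply: (@continuous_comp _ _ _ (fun t : R => (y, t)) ush); last exact: cush.
  by apply: continuous_pair => ?; [exact: cvg_cst | exact: cvg_id].
- move=> t.
  have -> : (fun t => phi (ush (y, t))) = (fun t => phi ((y, 0) + t *: ((s, 1) : R * R))).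
    by apply/funext => t'; rewrite lineE.
  rewrite /h -D_shear lineE; apply: is_derive_line; exact: phi_diff.
- by move=> t Bt; apply: phi_out; exact: out.
- by move=> t Bt; apply: h_out; exact: out.
Qed.

Lemma integral_left_half_ge0 (s : R) :
  (mu \x mu)%E.-integrable setT (fun p : TR * TR =>
     (P p * \1_([set p : TR * TR | p.1 < s * p.2]) p)%:E) /\
  (0 <= \int[mu \x mu]_p
     (P p * \1_([set p : TR * TR | p.1 < s * p.2]%R) p)%:E)%E.
Proof.
set A := [set p | _].
have mA : measurable A.
  apply: open_prod_measurable.
  have -> : A = (fun p : R * R => s * p.2 - p.1) @^-1` [set x | 0 < x].
    by apply/seteqP; split => p; rewrite /A /= subr_gt0.
  have c : continuous (fun p : R * R => s * p.2 - p.1).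
    move=> p; apply: cvgB; last exact: cvg_fst.
    by apply: cvgM; [exact: cvg_cst | exact: cvg_snd].
  by move/continuousP : c; apply; exact: open_gt.
have P_out p : ~ K p -> P p = 0 by exact: D_out.
have int_f := compact_support_integrable P K A cP cK P_out mA.
split; first exact: int_f.
rewrite -(integral21_prod_meas1 int_f) /fubini_G.
have [B HB] := bounded_outside.
apply: integral_ge0 => t _.
have out x : B < `|x| -> ~ K (x, t) by move=> Bx; apply: HB; left.
(* At each fixed time, only the value of [phi] on the shock line survives, and it is nonnegative. *)
suff -> : (\int[mu]_x (P (x, t) * \1_A (x, t))%:E = (phi (s * t, t))%:E)%E.
  by rewrite lee_fin; have [] := test.
have cPt : continuous (fun x : R => P (x, t)).
  move=> x; apply: (@continuous_comp _ _ _ (fun x : R => (x, t)) P); last exact: cP.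
  by apply: continuous_pair => ?; [exact: cvg_id | exact: cvg_cst].
have dphi (x : R) : is_derive x (1 : R) (fun x => phi (x, t)) (P (x, t)).
  have lineE y : (y, t) = (0, t) + y *: ((1, 0) : R * R).
    by congr pair; rewrite /= /GRing.scale /= ?mulr1 ?mulr0 ?add0r ?addr0.
  have -> : (fun x => phi (x, t)) = (fun x => phi ((0, t) + x *: ((1, 0) : R * R))).
    by apply/funext => y; rewrite lineE.
  rewrite (lineE x); exact: (is_derive_line phi (0, t) (1, 0) x (phi_diff _)).
rewrite -(integral_compact_FTC _ _ B (s * t) cPt dphi).
- by apply: eq_integral => x _; rewrite indicE /A; congr (_ * _%:R)%:E;
    congr nat_of_bool; apply/idP/idP; rewrite inE.
- by move=> x Bx; apply: phi_out; exact: out.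
- by move=> x Bx; apply: P_out; exact: out.
Qed.

(** Integrability is bundled with the sign so that sums and multiples can be assembled term by
    term. *)
Let nonneg_int (f : TR * TR -> R) : Prop :=
  (mu \x mu)%E.-integrable setT (fun p => (f p)%:E) /\
  (0 <= \int[mu \x mu]_p (f p)%:E)%E.

Let nonneg_intD f g : nonneg_int f -> nonneg_int g -> nonneg_int (fun p => f p + g p).
Proof.
move=> [f1 f2] [g1 g2]; split.
  by under eq_fun do rewrite EFinD; exact: integrableD.
under eq_integral do rewrite EFinD.
by rewrite integralD//; exact: adde_ge0.
Qed.

Let nonneg_intZ a f : 0 <= a -> nonneg_int f -> nonneg_int (fun p => a * f p).
Proof.
move=> a0 [f1 f2]; split.
  by under eq_fun do rewrite EFinM; exact: integrableZl.
under eq_integral do rewrite EFinM.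
by rewrite integralZl//; apply: mule_ge0.
Qed.

Let nonneg_int0 a f : (mu \x mu)%E.-integrable setT (fun p => (f p)%:E) ->
  (\int[mu \x mu]_p (f p)%:E = 0)%E -> nonneg_int (fun p => a * f p).
Proof.
move=> f1 f2; split.
  by under eq_fun do rewrite EFinM; exact: integrableZl.
under eq_integral do rewrite EFinM.
by rewrite integralZl// f2 mule0.
Qed.

Lemma two_shock_entropy_integral_ge0 (eta q : R * R -> R) (Ul Um Ur : R * R) (s1 s2 : R) :
  s1 < s2 ->
  s1 * (eta Ul - eta Um) <= q Ul - q Um ->
  s2 * (eta Um - eta Ur) <= q Um - q Ur ->
  (0 <= \int[mu \x mu]_(p in [set p : TR * TR | (0 < p.2)%R])
          (eta (two_shock_solution Ul Um Ur s1 s2 p) * Q p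
           + q (two_shock_solution Ul Um Ur s1 s2 p) * P p)%:E)%E.
Proof.
move=> s12 J1 J2.
have shear s (Y : set R) a (mY : measurable (Y : set TR)) :=
  nonneg_int0 a _ (integral_shear_derivative s _ mY).1 (integral_shear_derivative s _ mY).2.
(* The constant part [eta Ur * Q + q Ur * P] is split as [(eta Ur - q Ur) * Q + q Ur * (Q + P)], the
   shears of speed 0 and 1 over the whole line. The shear terms have integral zero, so their
   coefficients may have any sign. The last two coefficients are nonnegative by [J1] and [J2]. *)
have N := nonneg_intD _ _ (nonneg_intD _ _ (nonneg_intD _ _ (nonneg_intD _ _ (nonneg_intD _ _
  (shear 0 setT (eta Ur - q Ur) measurableT)
  (shear 1 setT (q Ur) measurableT))
  (shear s1 `]-oo, 0[%classic (eta Ul - eta Um) (measurable_itv _)))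
  (shear s2 `]-oo, 0[%classic (eta Um - eta Ur) (measurable_itv _)))
  (nonneg_intZ (q Ul - q Um - s1 * (eta Ul - eta Um)) _ ltac:(lra) (integral_left_half_ge0 s1)))
  (nonneg_intZ (q Um - q Ur - s2 * (eta Um - eta Ur)) _ ltac:(lra) (integral_left_half_ge0 s2)).
rewrite integral_mkcond; case: N => _; congr (0 <= _)%E.
apply: eq_integral => p _; rewrite patchE.
have HT (s : R) : \1_([set p : TR * TR | [set: TR] (p.1 - s * p.2)]) p = 1 :> R.
  by rewrite indicE mem_set.
have HY (s : R) : \1_([set p : TR * TR | `]-oo, 0[%classic (p.1 - s * p.2)]) p
    = (p.1 < s * p.2)%R%:R :> R.
  rewrite indicE; congr (_ %:R); congr nat_of_bool.
  by apply/idP/idP; rewrite inE /= in_itv /= subr_lt0.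
have HL (s : R) : \1_([set p : TR * TR | p.1 < s * p.2]) p = (p.1 < s * p.2)%R%:R :> R.
  by rewrite indicE; congr (_ %:R); congr nat_of_bool; apply/idP/idP; rewrite inE.
rewrite !HT !HY !HL.
(* Outside the open half plane [phi] and its derivatives vanish, so the whole-plane integrand agrees
   with the restricted one. *)
have [p0|p0] := boolP (p \in _); last first.
  have nK : ~ K p.
    move=> Kp; move/negP : p0; apply; rewrite inE /=.
    by have [_ _ _] := test; apply.
  by rewrite /P /Q !D_out// !(mulr0, mul0r, addr0).
have {}p0 : 0 < p.2 by move: p0; rewrite inE.
congr EFin; rewrite /two_shock_solution.
have [x1|x1] := ltP p.1 (s1 * p.2).
  have -> : p.1 < s2 * p.2 by rewrite (lt_trans x1)// ltr_pM2r.
  by rewrite /=; ring.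
by have [x2|x2] := ltP p.1 (s2 * p.2); rewrite /=; ring.
Qed.

End TestFunction.

(** * Entropy admissibility of the two-shock solution *)

Lemma brio_entropy_admissible (R : realType) (e ul rl ur rr : R) (Um : R * R) (s1 s2 : R) :
  0 < e < 4 * rl ^+ 2 -> 0 < rl -> 0 < rr ->
  lax_two_shock e (ul, rl) (ur, rr) Um s1 s2 ->
  entropy_admissible (brio_eta e) (brio_q e)
    (two_shock_solution (ul, rl) Um (ur, rr) s1 s2).
Proof.
move=> e4 rl0 rr0 lax phi test; have /andP[e0 _] := e4.
have [_ _ s12] := lax.
move: lax => /(lax_two_shockP _ _ _ _ _ _ _ _ e4 rl0 rr0).
move=> [p [k1 [k2 [[rlp rrp k10 k20] [C1 C2] UmE D [s1E s2E]]]]].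
have u2 : ul + k1 * (p - rl) = ur + k2 * (p - rr) by lra.
have J1 := brio_entropy_jump _ _ _ _ _ _ _ C1 erefl s1E.
have J2 := brio_entropy_jump _ _ _ _ _ _ _ C2 erefl s2E.
have pos k r : r < p -> 0 < (p - r) ^+ 3 * (k ^+ 2 + 3 * e) / 12.
  move=> rp; apply: divr_gt0 => //; apply: mulr_gt0.
    by rewrite exprn_gt0// subr_gt0.
  by rewrite ltr_wpDl ?sqr_ge0// mulr_gt0.
(* Both jumps are taken from the outer to the intermediate state: against the left-minus-right
   orientation for the first shock, along it for the second. The opposite signs of [k1] and [k2]
   thus give both inequalities. *)
have S1 : k1 * ((p - rl) ^+ 3 * (k1 ^+ 2 + 3 * e) / 12) < 0.
  by rewrite nmulr_rlt0// pos.
have S2 : 0 < k2 * ((p - rr) ^+ 3 * (k2 ^+ 2 + 3 * e) / 12).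
  by rewrite mulr_gt0// pos.
apply: two_shock_entropy_integral_ge0 => //; rewrite /brio_eta /brio_q UmE /=.
  lra.
rewrite u2; lra.
Qed.

Theorem mainTheorem4 (R : realType) :
  (forall e : R, 0 < e ->
     entropy_pair (brio_flux e) (brio_eta e) (brio_q e) /\
     strictly_convex (brio_eta e)) /\
  (forall ul ur rhol rhor : R, ur < ul -> 0 < rhol -> 0 < rhor ->
     exists e0 : R, 0 < e0 /\
       forall e : R, 0 < e < e0 ->
         (exists! w : (R * R) * (R * R),
            lax_two_shock e (ul, rhol) (ur, rhor) w.1 w.2.1 w.2.2) /\
         (forall (Um : R * R) (s1 s2 : R),
            lax_two_shock e (ul, rhol) (ur, rhor) Um s1 s2 ->
            entropy_admissible (brio_eta e) (brio_q e)
              (two_shock_solution (ul, rhol) Um (ur, rhor) s1 s2))).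
Proof.
split.
  move=> e e0; split; first exact: brio_entropy_pair.
  exact: brio_eta_strictly_convex.
move=> ul ur rl rr ulr rl0 rr0.
pose c := (ul - ur) / (3 + 4 * Num.max rl rr).
have c0 : 0 < c.
  by rewrite divr_gt0 ?subr_gt0// addr_gt0// mulr_gt0// lt_max rl0.
(* The bound 1 gives [e <= Num.sqrt e], the bound [4 * rl ^+ 2] excludes negative intermediate
   densities, and [c ^+ 2] keeps the velocity jump at the larger outer density below [ul - ur]. *)
exists (Num.min 1 (Num.min (4 * rl ^+ 2) (c ^+ 2))); split.
  by rewrite !lt_min ltr01 mulr_gt0 ?exprn_gt0.
move=> e /andP[e0]; rewrite !lt_min => /and3P[e1 e4 ec].
have e04 : 0 < e < 4 * rl ^+ 2 by rewrite e0.
split; last by move=> Um s1 s2; exact: brio_entropy_admissible.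
have [Um [s1 [s2 lax]]] := lax_two_shock_exists ul rl ur rr e ulr rl0 rr0 e0 e1 e4 ec.
exists (Um, (s1, s2)); split => // -[Um' [s1' s2']] /= lax'.
by have [-> -> ->] := lax_two_shock_unique _ _ _ _ _ _ _ _ _ _ _ e04 rl0 rr0 lax lax'.
Qed.
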